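(* There is an absolute constant $c>0$ such that for every integer $h\geq 5$ and every positive integer $\Delta$ with $\Delta\equiv 0\pmod {h-2}$ if $h\geq 6$, and $\Delta\equiv 0\pmod 3$ if $h=5$, there exist infinitely many $K_{h}$-minor-free graphs $G$ with $\Delta(G)=\Delta$ and $$\mathrm{cr}(G)\geq c\,h\,\Delta \cdot |V(G)|.$$ Moreover, for $h\geq 6$ these graphs $G$ can be taken to be chordal.
   Context: All graphs are undirected, simple and finite. $\Delta(G)$ denotes the maximum degree of $G$. A graph is chordal if every induced cycle is a triangle. A drawing of a graph represents each vertex by a distinct point in the plane and each edge by a simple curve between its endpoints, such that the only vertices an edge intersects are its own endpoints, and no three edges intersect at a common point (except at a common endpoint). A crossing is a point of intersection between two edges other than a common endpoint. The crossing number $\mathrm{cr}(G)$ is the minimum number of crossings in a drawing of $G$ in the plane. *)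

(* Defs.v *)
From HB Require Import structures.
From mathcomp Require Import all_boot all_order all_algebra.

Set Implicit Arguments.
Unset Strict Implicit.
Unset Printing Implicit Defensive.

Import Order.TTheory GRing.Theory Num.Theory.

(** MathComp and MathComp-Analysis.  The latter is loaded only after the graph
    notions because it shadows notations on finite sets. *)

Record sgraph := SGraph {
  vertex :> finType;
  adj : rel vertex;
  adj_sym : symmetric adj;
  adj_irrefl : irreflexive adj }.

Definition giso (G H : sgraph) : Prop :=
  exists2 f : G -> H, bijective f & forall x y, adj (f x) (f y) = adj x y.

Definition degree (G : sgraph) (v : G) : nat := #|[set u | adj v u]|.

Definition max_degree (G : sgraph) : nat := \max_(v : G) degree v.

Definition edges (G : sgraph) : {set {set G}} :=
  [set [set p.1; p.2] | p in [set p : G * G | adj p.1 p.2]].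

(** [s] lists, in cyclic order, the vertices of a cycle without chords.  The
    size condition is needed because [cycle] accepts [[:: x; y]] for an edge. *)
Definition induced_cycle (G : sgraph) (s : seq G) : Prop :=
  [/\ 3 <= size s, uniq s, cycle (@adj G) s
    & forall x y, x \in s -> y \in s -> adj x y -> y = next s x \/ x = next s y].

Definition chordal (G : sgraph) : Prop :=
  forall s : seq G, induced_cycle s -> size s = 3.

Definition connected_set (G : sgraph) (A : {set G}) : Prop :=
  A != set0 /\
  {in A &, forall x y,
    connect [rel u v | [&& u \in A, v \in A & adj u v]] x y}.

(** [B x] is the branch set that is contracted to the vertex [x] of [H]. *)
Definition is_minor (H G : sgraph) : Prop :=
  exists B : H -> {set G},
    [/\ forall x, connected_set (B x),
        forall x y, x != y -> [disjoint B x & B y]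
      & forall x y, adj x y ->
          exists u v, [/\ u \in B x, v \in B y & adj u v]].

Definition complete_rel (n : nat) : rel 'I_n := fun i j => i != j.

Lemma complete_sym n : symmetric (@complete_rel n).
Proof. by move=> i j; rewrite /complete_rel eq_sym. Qed.

Lemma complete_irrefl n : irreflexive (@complete_rel n).
Proof. by move=> i; rewrite /complete_rel eqxx. Qed.

Definition complete_graph (n : nat) : sgraph :=
  SGraph (@complete_sym n) (@complete_irrefl n).

From mathcomp Require Import all_classical all_reals all_analysis.

Import numFieldNormedType.Exports.

Local Open Scope classical_set_scope.
Local Open Scope ring_scope.

Definition simple_curve (R : realType) (a b : R * R) (A : set (R * R)) : Prop :=
  exists f : R -> R * R,
    [/\ {within `[0, 1], continuous f},
        {in `[0, 1] &, injective f},
        f 0 = a, f 1 = b & A = f @` `[0, 1]].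

(** Values of [curve] outside [edges G] are irrelevant. *)
Record drawing (R : realType) (G : sgraph) := Drawing {
  pos : G -> R * R;
  curve : {set G} -> set (R * R);
  pos_inj : injective pos;
  curve_simple : forall u v : G, adj u v ->
    simple_curve (pos u) (pos v) (curve [set u; v]%SET);
  curve_vertex : forall (e : {set G}) (v : G), e \in edges G ->
    curve e (pos v) -> v \in e;
  curve_triple : forall (e1 e2 e3 : {set G}) (x : R * R),
    e1 \in edges G -> e2 \in edges G -> e3 \in edges G ->
    e1 != e2 -> e1 != e3 -> e2 != e3 ->
    curve e1 x -> curve e2 x -> curve e3 x ->
    exists v : G, [/\ v \in e1, v \in e2, v \in e3 & x = pos v] }.

Definition crossings (R : realType) (G : sgraph) (D : drawing R G) :
    set (R * R) :=
  [set x | exists e1 e2 : {set G},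
    [/\ e1 \in edges G, e2 \in edges G & e1 != e2] /\
    [/\ curve D e1 x, curve D e2 x
      & ~ exists v : G, [/\ v \in e1, v \in e2 & x = pos D v]]].

(** Drawings with infinitely many crossings do not affect the minimum.  The
    infimum is a minimum, and is finite: a straight-line drawing in general
    position has finitely many crossings. *)
Definition crossing_number (R : realType) (G : sgraph) : \bar R :=
  ereal_inf [set k%:R%:E | k in
    [set k : nat | exists D : drawing R G, (crossings D #= `I_k)%card]].

(* Main.v *)
Require Import Defs.
From HB Require Import structures.
From mathcomp Require Import all_boot all_order all_algebra.
From mathcomp Require Import zify lra.
From Stdlib Require Import Btauto.

Set Implicit Arguments.
Unset Strict Implicit.
Unset Printing Implicit Defensive.

Import Order.TTheory GRing.Theory Num.Theory.

(** The graphs are disjoint copies of the join of [p <= h - 2] vertices, forming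
    a clique when [h >= 6], with [m] independent vertices.  Such a join has no
    [K_h] minor, since a branch set avoiding the [p] vertices is a single
    independent vertex, and two of these are not adjacent.

    For the crossing number, split the [p] vertices into [q] triples and the
    independent ones into three blocks of size [k].  The triples
    [(s, t, s + t mod k)] of one vertex per block meet pairwise in at most one
    vertex, so each of the [q * k^2] copies of [K_{3,3}] that they span with the
    [q] triples contributes its own crossing, provided that every drawing of
    [K_{3,3}] has two crossing edges without a common endpoint.

    This follows from a mod 2 count.  If the paths [e] and [f] are disjoint, then
    [e s - f t] never vanishes on the unit square, so the number of crossings of
    a ray by its values along the boundary is even.  This relates the parities
    of the crossings of [e] with rays from the endpoints of [f] to those of [f]
    with rays from the endpoints of [e]; the sum of these relations over all
    pairs of independent edges of [K_{3,3}] is [0 = 1].  The same holds for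
    [K_5], which is the join needed for [h = 6] and maximum degree 4. *)

(** * Joins of a clique or an independent set with an independent set *)

(** Once [s] is rotated to start at [y], a longer list would continue with further distinct entries
    before returning to [y]. On a cycle this separates the two neighbours of [y]; the next lemma
    recognises a triangle. *)
Lemma size_next2 (T : eqType) (s : seq T) y : uniq s -> y \in s ->
  next s (next s y) = y -> size s <= 2.
Proof.
move=> us ys; have [i t st] := rot_to ys.
rewrite -!(next_rot i us) -(size_rot i) st.
move: us; rewrite -(rot_uniq i) st; case: t {st} => [|z [|w t]] //=.
rewrite !inE !eqxx !negb_or => /and3P[/and3P[yz yw _] _ _].
by rewrite eq_sym (negPf yz) => wy; rewrite wy eqxx in yw.
Qed.

Lemma size_next3 (T : eqType) (s : seq T) y : uniq s -> y \in s ->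
  next s (next s (next s y)) = y -> size s <= 3.
Proof.
move=> us ys; have [i t st] := rot_to ys.
rewrite -!(next_rot i us) -(size_rot i) st.
move: us; rewrite -(rot_uniq i) st; case: t {st} => [|z [|w [|u t]]] //=.
rewrite !inE !eqxx !negb_or => /and4P[/and4P[yz yw yu _] /and3P[zw _ _] _ _].
rewrite ![_ == y]eq_sym (negPf yz) (negPf yw) eqxx [w == z]eq_sym (negPf zw) => uy.
by rewrite uy eqxx in yu.
Qed.

Section Join.
Variables (b : bool) (p m N : nat).

(** The first component numbers the disjoint copies. The flag [b] lets one family serve [h = 5],
    with two independent sides, and [h >= 6], with a clique on the [inl] side. *)
Definition join_adj : rel ('I_N * ('I_p + 'I_m)) := fun u v =>
  (u.1 == v.1) && match u.2, v.2 with
    | inl i, inl j => b && (i != j)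
    | inr _, inr _ => false
    | _, _ => true
    end.

Lemma join_adj_sym : symmetric join_adj.
Proof.
by move=> [c [i|i]] [c' [j|j]]; rewrite /join_adj /= (eq_sym c) // (eq_sym i).
Qed.

Lemma join_adj_irrefl : irreflexive join_adj.
Proof. by move=> [c [i|i]]; rewrite /join_adj /= ?eqxx ?andbF. Qed.

Definition join_graph : sgraph := SGraph join_adj_sym join_adj_irrefl.

Lemma card_join_graph : #|join_graph| = N * (p + m).
Proof. by rewrite card_prod card_sum !card_ord. Qed.

Lemma degree_join (v : join_graph) :
  degree v = if v.2 is inl _ then b * p.-1 + m else p.
Proof.
case: v => c x; rewrite /degree.
have -> : [set u | adj ((c, x) : join_graph) u] =
    pair c @: [set y | join_adj (c, x) (c, y)].
  apply/setP => -[c' y]; rewrite !inE; apply/idP/imsetP => [cy|[z]].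
    by exists y; [rewrite inE|congr pair]; case/andP: cy => /eqP/= ->;
      rewrite // /join_adj eqxx.
  by rewrite inE => cz [-> ->].
rewrite card_imset; last by move=> ? ? [].
rewrite -sum1dep_card big_sumType /=; case: x => i; rewrite /join_adj /= eqxx /=.
- rewrite !sum1_card; congr (_ + _); last by rewrite card_ord.
  case: b => /=; last by rewrite eq_card0.
  by rewrite mul1n; have := cardC1 i; rewrite card_ord => <-;
    apply: eq_card => j; rewrite !inE eq_sym.
- by rewrite sum1_card card_ord big_pred0 ?addn0.
Qed.

(** The last hypothesis says that the degree [p] of an [inr] vertex does not exceed that of an [inl]
    vertex. *)
Lemma max_degree_join : 0 < N -> 0 < p -> p <= b * p.-1 + m ->
  max_degree join_graph = b * p.-1 + m.
Proof.
move=> N0 p0 pm; apply/eqP; rewrite eqn_leq; apply/andP; split.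
  by apply/bigmax_leqP => v _; rewrite degree_join; case: v.2.
apply: (leq_trans _ (leq_bigmax ((Ordinal N0, inl (Ordinal p0)) : join_graph))).
by rewrite degree_join.
Qed.

Lemma join_graph_connect (A : {set join_graph}) u v :
  connect [rel u v | [&& u \in A, v \in A & adj u v]] u v -> u.1 = v.1.
Proof.
case/connectP => s; elim: s u => [|w s IH] u /=; first by move=> _ ->.
by case/andP => /and3P[_ _ /andP[/eqP-> _]] /IH/[apply].
Qed.

(** At most one branch set avoids the [inl] vertices, and the others inject into the indices of the
    [inl] vertices that they contain, so [h <= p + 1]. *)
Lemma join_graph_minor h : p + 2 <= h -> ~ is_minor (complete_graph h) join_graph.
Proof.
move=> ph [B [Bconn Bdisj Badj]].
pose hasl (x : 'I_h) := [exists v, (v \in B x) && (if v.2 is inl _ then true else false)].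
(* Branch sets are connected and pairwise adjacent, so all lie in one copy. Hence an index in
   ['I_p], without the copy number, identifies an [inl] vertex. *)
have one_copy x y u v : u \in B x -> v \in B y -> u.1 = v.1.
  have same z (u' v' : join_graph) : u' \in B z -> v' \in B z -> u'.1 = v'.1.
    by case: (Bconn z) => _ cz ? ?; apply: (@join_graph_connect (B z)); exact: cz.
  have [<-|xy] := eqVneq x y; first exact: same.
  have [u' [v' [Bu' Bv' /andP[/eqP uv' _]]]] := Badj x y xy.
  by move=> Bu Bv; rewrite (same x u u') // (same y v v').
have few : #|[predC hasl]| <= 1.
  apply/card_le1P => x nx y; rewrite !inE in nx *; apply/idP/eqP => [ny|->] //.
  apply/eqP/contraT; rewrite eq_sym => xy.
  have [u [v [Bu Bv]]] := Badj x y xy.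
  move: nx ny; rewrite /hasl !negb_exists => /forallP/(_ u) + /forallP/(_ v).
  by rewrite Bu Bv /= /adj /= /join_adj; case: u.2; case: v.2; rewrite ?andbF.
pose g (x : 'I_h) : option 'I_p := [pick i | [exists c, (c, inl i) \in B x]].
have gP x : hasl x -> exists c i, g x = Some i /\ (c, inl i) \in B x.
  case/existsP => -[c [i|i]] /andP[] //= Bx _; rewrite /g.
  case: pickP => [j /existsP[c' Bj]|/(_ i)/existsP[]]; last by exists c.
  by exists c', j.
have inj_g : {in hasl &, injective g}.
  move=> x y /gP[c [i [-> Bx]]] /gP[c' [j [-> By]]] [ij].
  have /= cc := one_copy _ _ _ _ Bx By; rewrite -ij -cc in By.
  apply/eqP/contraT => /Bdisj/pred0P/(_ (c, inl i)) /=.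
  by rewrite Bx By.
have : #|hasl| <= #|[set Some i | i : 'I_p]|.
  rewrite -(card_in_imset inj_g); apply/subset_leq_card/subsetP => _ /imsetP[x hx ->].
  by case: (gP x hx) => c [i [-> _]]; apply: imset_f.
rewrite card_imset; last by move=> ? ? [].
have := cardC hasl; rewrite !card_ord => sum_h hp.
have : h <= p + 1 by rewrite -sum_h leq_add.
by rewrite leqNgt (leq_trans _ ph) ?addn1 ?addn2.
Qed.

(** Some vertex of the cycle has both its cycle neighbours in the clique. These are adjacent, and in
    the absence of chords their edge closes a triangle. *)
Lemma join_graph_chordal : b = true -> chordal join_graph.
Proof.
move=> bT s [s3 us cs nochord].
have nbr v : v \in s -> adj v (next s v) /\ adj v (prev s v).
  by move=> vs; rewrite (next_cycle cs vs) adj_sym (prev_cycle cs vs).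
have cliq (u v : join_graph) i j c c' : u = (c, inl i) -> v = (c', inl j) ->
    c = c' -> u != v -> adj u v.
  move=> -> -> ->; rewrite /= /join_adj /= bT eqxx /=.
  by apply: contraNN => /eqP->.
(* An [inr] vertex has only [inl] neighbours; if the cycle contains none, any of its vertices will
   do. *)
have [y ys [[c [i pE]] [c' [j nE]]]] : exists2 y, y \in s &
    (exists c i, prev s y = (c, inl i)) /\ (exists c i, next s y = (c, inl i)).
  have [/existsP[[c [i|i]] /andP[ys /=]] //|/existsPn noR] :=
      boolP [exists v, (v \in s) && (if v.2 is inr _ then true else false)].
    exists (c, inr i) => //; have := nbr _ ys.
    have inlE v : @adj join_graph (c, inr i) v -> exists c j, v = (c, inl j).
      by case: v => c1 [j|j]; [exists c1, j|rewrite /= /join_adj /= andbF].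
    by case=> /inlE ? /inlE.
  have inlE v : v \in s -> exists c i, v = (c, inl i).
    by move=> vs; have := noR v; rewrite vs; case: v {vs} => c [i|i] //; exists c, i.
  have [v vs] : exists v, v \in s by case: (s) s3 => // v ? _; exists v; rewrite inE eqxx.
  by exists v => //; split; apply: inlE; rewrite ?mem_prev ?mem_next.
have [yn yp] := nbr y ys.
have next_neq : next s y != prev s y.
  apply: contraTneq s3 => ny; rewrite -ltnNge ltnS.
  by apply: (size_next2 us ys); rewrite ny next_prev.
have cc : c = c'.
  by move: yn yp; rewrite pE nE => /andP[/eqP/= <- _] /andP[/eqP/= <- _].
have pn : adj (prev s y) (next s y) by apply: (cliq _ _ _ _ _ _ pE nE cc); rewrite eq_sym.
have [|||pny] := nochord _ _ _ _ pn; rewrite ?mem_next ?mem_prev //.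
  by rewrite next_prev // => ny; rewrite ny adj_irrefl in yn.
apply/eqP; rewrite eqn_leq s3 andbT; apply: (size_next3 us ys).
by rewrite -pny next_prev.
Qed.
End Join.

(** * Sums of the parity relations over K33 and K5 *)

Lemma addb_xorb a b : a (+) b = xorb a b.
Proof. by case: a. Qed.

(* Refutes a sum of equations in F_2 whose two sides differ by the constant 1
   once equal terms are cancelled. *)
Ltac sum_contradiction E :=
  rewrite !addb_xorb in E; move: E;
  match goal with |- ?l = ?r -> _ =>
    suff: xorb l r = true; [by move=> + E; rewrite E; case: r | btauto] end.

(** Sum the 18 relations for pairs of independent edges. Each value of [na] and [nb] occurs twice,
    each [ua] and [uab] term an even number of times, and the 18 negations cancel. Each pair [j],
    [l] gives [ub l j (+) ub j l = true] once per pair [i], [k], hence nine times, which is odd. *)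
Lemma K33_parity (na nb : 'I_3 -> 'I_3 -> 'I_3 -> bool) (ua ub uab : rel 'I_3) :
  (forall i k, i != k -> ua k i = ~~ ua i k) ->
  (forall j l, j != l -> ub l j = ~~ ub j l) ->
  ~ forall i j k l, i != k -> j != l ->
    na i j k (+) nb i j l (+) (na k l i (+) nb k l j) =
    ua k i (+) ~~ uab i l (+) (uab k j (+) ub l j).
Proof.
move=> hua hub H.
pose o0 : 'I_3 := @Ordinal 3 0 isT.
pose o1 : 'I_3 := @Ordinal 3 1 isT.
pose o2 : 'I_3 := @Ordinal 3 2 isT.
pose H6 (i k : 'I_3) ik := congr2 addb
  (congr2 addb (congr2 addb (H i o0 k o1 ik isT) (H i o1 k o0 ik isT))
               (congr2 addb (H i o0 k o2 ik isT) (H i o2 k o0 ik isT)))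
  (congr2 addb (H i o1 k o2 ik isT) (H i o2 k o1 ik isT)).
have E := congr2 addb (H6 o0 o1 isT) (congr2 addb (H6 o0 o2 isT) (H6 o1 o2 isT)).
rewrite /= (hua o0 o1) ?(hua o0 o2) ?(hua o1 o2)
  ?(hub o0 o1) ?(hub o0 o2) ?(hub o1 o2) // in E.
sum_contradiction E.
Qed.

(** Sum the 15 relations. Each [n i j k] occurs for the two remaining choices of [l], and each pair
    of vertices occurs six times under [u]. Of the twelve [u] terms of four vertices, nine have the
    larger index first, and 5 * 9 is odd. *)
Lemma K5_parity (n : 'I_5 -> 'I_5 -> 'I_5 -> bool) (u : rel 'I_5) :
  (forall i k, i != k -> u k i = ~~ u i k) ->
  ~ forall i j k l : 'I_5, uniq [:: i; j; k; l] -> (i < j)%N -> (k < l)%N ->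
    n i j k (+) n i j l (+) (n k l i (+) n k l j) =
    u k i (+) u l i (+) (u k j (+) u l j).
Proof.
move=> hu H.
pose o0 : 'I_5 := @Ordinal 5 0 isT.
pose o1 : 'I_5 := @Ordinal 5 1 isT.
pose o2 : 'I_5 := @Ordinal 5 2 isT.
pose o3 : 'I_5 := @Ordinal 5 3 isT.
pose o4 : 'I_5 := @Ordinal 5 4 isT.
have E := congr2 addb (congr2 addb
  (congr2 addb (@H o0 o1 o2 o3 isT isT isT)
    (congr2 addb (@H o0 o2 o1 o3 isT isT isT) (@H o0 o3 o1 o2 isT isT isT)))
  (congr2 addb (@H o0 o1 o2 o4 isT isT isT)
    (congr2 addb (@H o0 o2 o1 o4 isT isT isT) (@H o0 o4 o1 o2 isT isT isT))))
  (congr2 addb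
  (congr2 addb (@H o0 o1 o3 o4 isT isT isT)
    (congr2 addb (@H o0 o3 o1 o4 isT isT isT) (@H o0 o4 o1 o3 isT isT isT)))
  (congr2 addb
  (congr2 addb (@H o0 o2 o3 o4 isT isT isT)
    (congr2 addb (@H o0 o3 o2 o4 isT isT isT) (@H o0 o4 o2 o3 isT isT isT)))
  (congr2 addb (@H o1 o2 o3 o4 isT isT isT)
    (congr2 addb (@H o1 o3 o2 o4 isT isT isT) (@H o1 o4 o2 o3 isT isT isT))))).
rewrite /= in E; rewrite ?(hu o0 o1) ?(hu o0 o2) ?(hu o0 o3) ?(hu o0 o4)
  ?(hu o1 o2) ?(hu o1 o3) ?(hu o1 o4) ?(hu o2 o3) ?(hu o2 o4) ?(hu o3 o4) // in E.
sum_contradiction E.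
Qed.

From mathcomp Require Import all_classical all_reals all_analysis.

Import numFieldNormedType.Exports.

Local Open Scope ring_scope.

(** * Ray-crossing parity of disjoint plane curves *)

Section RayCrossing.
Local Open Scope classical_set_scope.
Variable R : realType.
Implicit Types (z w : R * R) (e f : R -> R * R) (W : set (R * R)).

(** The positive x-axis is included and the negative one excluded, so that exactly one of [z] and
    [- z] is upper for every nonzero [z]. No general position is then required. *)
Definition upper z : bool := (0 < z.2) || (z.2 == 0) && (0 < z.1).

Lemma upperN z : z != 0 -> upper (- z) = ~~ upper z.
Proof.
case: z => x y; rewrite /upper /= oppr_gt0 oppr_eq0 oppr_gt0.
rewrite -[0]/((0, 0) : R * R) xpair_eqE.
by case: (ltgtP y 0) => _; case: (ltgtP x 0).
Qed.

Lemma upper_gt0 z : 0 < z.2 -> upper z.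
Proof. by rewrite /upper => ->. Qed.

Lemma upper_lt0 z : z.2 < 0 -> upper z = false.
Proof. by rewrite /upper => z0; rewrite lt_gtF // lt_eqF. Qed.

(* Whether the segment from [z] to [w] crosses the negative x-axis; meaningful
   only when [z] and [w] lie in a common [one_sided] set. *)
Definition ray_step z w : bool := (upper z (+) upper w) && (z.1 < 0).

(** The four open half-planes cover the plane without the origin, and inside each of them [ray_step]
    depends only on the endpoints of a path. *)
Definition one_sided W : Prop :=
  [\/ forall z, W z -> z.1 < 0, forall z, W z -> 0 < z.1,
      forall z, W z -> z.2 < 0 | forall z, W z -> 0 < z.2].

(** A closed loop in a half-plane missing the origin crosses the ray an even number of times: on the
    left the changes of [upper] telescope, and in the other half-planes every step is 0. *)
Lemma ray_step_cell W z00 z10 z11 z01 : one_sided W ->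
  W z00 -> W z10 -> W z11 -> W z01 ->
  ray_step z00 z10 (+) ray_step z10 z11 (+)
    (ray_step z01 z11 (+) ray_step z00 z01) = false.
Proof.
rewrite /ray_step => -[] sW /sW + /sW + /sW + /sW.
- by move=> -> -> _ ->; case: upper; case: upper; case: upper; case: upper.
- by move=> /ltW/le_gtF-> /ltW/le_gtF-> _ /ltW/le_gtF->; rewrite !andbF.
- by move=> a b c d; rewrite !upper_lt0.
- by move=> a b c d; rewrite !upper_gt0.
Qed.

(** The steps of [z, w] and of [- z, - w] record crossings of the negative and of the positive
    x-axis; together they account for every change of [upper]. *)
Lemma ray_stepN W z w : one_sided W -> W z -> W w -> z != 0 -> w != 0 ->
  ray_step z w = ray_step (- z) (- w) (+) (upper (- z) (+) upper (- w)).
Proof.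
move=> sW Wz Ww z0 w0; rewrite /ray_step !upperN // oppr_lt0.
case: sW => sW.
- by rewrite (sW _ Wz) lt_gtF ?sW//; case: upper; case: upper.
- by rewrite (sW _ Wz) lt_gtF ?sW//; case: upper; case: upper.
- by rewrite !upper_lt0 ?sW.
- by rewrite !upper_gt0 ?sW.
Qed.

Lemma nbhs_one_sided z : z != 0 -> exists2 V, nbhs z V & one_sided V.
Proof.
case: z => x y; rewrite -[0]/((0, 0) : R * R) xpair_eqE negb_and => xy0.
pose H1 (P : set R) := [set p : R * R | P p.1].
pose H2 (P : set R) := [set p : R * R | P p.2].
have n1 (P : set R) : nbhs x P -> nbhs (x, y) (H1 P).
  by move=> ?; exists (P, setT) => //=; [split=> //; exact: filterT|move=> ? []].
have n2 (P : set R) : nbhs y P -> nbhs (x, y) (H2 P).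
  by move=> ?; exists (setT, P) => //=; [split=> //; exact: filterT|move=> ? []].
case: (ltgtP x 0) xy0 => [x0 _|x0 _|x0 /=].
- by exists (H1 [set t | t < 0]); [apply/n1/lt_nbhsl|constructor 1].
- by exists (H1 [set t | 0 < t]); [apply/n1/lt_nbhsr|constructor 2].
case: (ltgtP y 0) => // y0 _.
- by exists (H2 [set t | t < 0]); [apply/n2/lt_nbhsl|constructor 3].
- by exists (H2 [set t | 0 < t]); [apply/n2/lt_nbhsr|constructor 4].
Qed.

(** * Subdivision of the unit square *)

Definition grid_cell e f (N i j : nat) : set (R * R) :=
  [set z | exists i' j', [/\ (i <= i' <= i.+1)%N, (j <= j' <= j.+1)%N
    & z = e (i'%:R / N.+1%:R) - f (j'%:R / N.+1%:R)]].

(** A Lebesgue number argument: [e s - f t] is locally one-sided, and compactness of the square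
    gives one mesh for all cells. *)
Lemma near_grid_cell e f : continuous e -> continuous f ->
  (forall s t : R, 0 <= s <= 1 -> 0 <= t <= 1 -> e s <> f t) ->
  \forall N \near \oo, forall i j, (i <= N)%N -> (j <= N)%N ->
    one_sided (grid_cell e f N i j).
Proof.
move=> ce cf ef.
pose F (p : R * R) := e p.1 - f p.2.
have cF : continuous F.
  move=> p; apply: cvgB.
    by apply: (@cvg_comp _ _ _ fst e); [exact: cvg_fst|exact: ce].
  by apply: (@cvg_comp _ _ _ snd f); [exact: cvg_snd|exact: cf].
pose P (N : nat) (p : R * R) := one_sided [set z | exists q : R * R,
  [/\ `|p.1 - q.1| <= N.+1%:R^-1, `|p.2 - q.2| <= N.+1%:R^-1 & z = F q]].
have K : compact ((`[0, 1]%classic : set R) `*` (`[0, 1]%classic : set R)).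
  by apply: compact_setX; exact: segment_compact.
have near_P (p : R * R) : (`[0, 1]%classic `*` `[0, 1]%classic) p ->
    \forall q \near p & N \near \oo, P N q.
  case=> /=; rewrite !in_itv /= => p1 p2.
  have /nbhs_one_sided[V /cF /nbhs_ballP[d /= d0 dV] sV] : F p != 0.
    by rewrite subr_eq0; apply/eqP/ef.
  have d20 : 0 < d / 2 by lra.
  near=> q N.
  have qp : ball p (d / 2) q by near: q; exact: nbhsx_ballx.
  have Nd : N.+1%:R^-1 < d / 2 by near: N; exact: (near_infty_natSinv_lt (PosNum d20)).
  have sub z : (exists r : R * R,
    [/\ `|q.1 - r.1| <= N.+1%:R^-1, `|q.2 - r.2| <= N.+1%:R^-1 & z = F r]) -> V z.
    case=> r [r1 r2 ->]; apply: dV; case: qp; rewrite /ball /= => q1 q2.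
    split; rewrite /ball /=.
      apply: le_lt_trans (ler_distD q.1 _ _) _; rewrite (splitr d).
      by apply: ltr_leD => //; apply: le_trans r1 (ltW Nd).
    apply: le_lt_trans (ler_distD q.2 _ _) _; rewrite (splitr d).
      by apply: ltr_leD => //; apply: le_trans r2 (ltW Nd).
  by case: sV => sV; [constructor 1|constructor 2|constructor 3|constructor 4]
    => z /sub /sV.
near=> N => i j iN jN.
have KN : (`[0, 1]%classic `*` `[0, 1]%classic) `<=` P N.
  by near: N; exact: (iffLR (compact_near_coveringP _) K _ \oo P _ near_P).
have in01 k : (k <= N)%N -> 0 <= (k%:R / N.+1%:R : R) <= 1.
  by move=> kN; rewrite divr_ge0 //= ler_pdivrMr // mul1r ler_nat leqW.
have step k k' : (k <= k' <= k.+1)%N ->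
    `|k%:R / N.+1%:R - k'%:R / N.+1%:R| <= N.+1%:R^-1 :> R.
  case/andP => kk' k'k; rewrite -mulrBl normrM distrC -natrB // [X in _ * X]ger0_norm //.
  by rewrite ger_pMl // normr_nat lern1 leq_subLR addn1.
have inK : (`[0, 1]%classic `*` `[0, 1]%classic)
    ((i%:R / N.+1%:R, j%:R / N.+1%:R) : R * R).
  by split; rewrite /= in_itv /= in01.
have sub z : grid_cell e f N i j z -> exists q : R * R,
    [/\ `|i%:R / N.+1%:R - q.1| <= N.+1%:R^-1,
       `|j%:R / N.+1%:R - q.2| <= N.+1%:R^-1 & z = F q].
  case=> i' [j' [ii' jj' ->]].
  by exists (i'%:R / N.+1%:R, j'%:R / N.+1%:R); split=> //=; exact: step.
by case: (KN _ inK) => /= sP;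
  [constructor 1|constructor 2|constructor 3|constructor 4] => z /sub /sP.
Unshelve. all: by end_near. Qed.

(** The parity of the crossings of [e], sampled at [N + 2] points, with the leftward horizontal ray
    from [v]. *)
Definition ray_parity e v (N : nat) : bool :=
  \big[addb/false]_(0 <= i < N.+1)
    ray_step (e (i%:R / N.+1%:R) - v) (e (i.+1%:R / N.+1%:R) - v).

(** Green's formula mod 2: inner grid edges cancel, so only the boundary of the square remains. *)
Lemma grid_sum n (h v : nat -> nat -> bool) :
  (forall i j, (i < n)%N -> (j < n)%N ->
    h i j (+) v i.+1 j (+) (h i j.+1 (+) v i j) = false) ->
  \big[addb/false]_(0 <= i < n) h i 0 (+) \big[addb/false]_(0 <= j < n) v n j =
  \big[addb/false]_(0 <= i < n) h i n (+) \big[addb/false]_(0 <= j < n) v 0 j.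
Proof.
move=> cell.
have row j m : (j < n)%N -> (m <= n)%N ->
    \big[addb/false]_(0 <= i < m) h i j (+) v m j =
    \big[addb/false]_(0 <= i < m) h i j.+1 (+) v 0 j.
  move=> jn; elim: m => [|m IH] mn; first by rewrite !big_nil.
  move: (IH (ltnW mn)) (cell m j mn jn); rewrite !big_nat_recr //=.
  by case: (h m j); case: (v m j); case: (h m j.+1); case: (v m.+1 j);
    case: (v 0 j); case: (\big[_/_]_(_ <= _ < _) h _ j);
    case: (\big[_/_]_(_ <= _ < _) h _ j.+1).
suff: forall m, (m <= n)%N ->
    \big[addb/false]_(0 <= i < n) h i 0 (+) \big[addb/false]_(0 <= j < m) v n j =
    \big[addb/false]_(0 <= i < n) h i m (+) \big[addb/false]_(0 <= j < m) v 0 j.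
  exact.
elim=> [|m IH] mn; first by rewrite !big_nil.
by rewrite !big_nat_recr //= addbA (IH (ltnW mn)) addbAC row // addbAC addbA.
Qed.

Lemma telescope_addb n (u : nat -> bool) :
  \big[addb/false]_(0 <= i < n) (u i (+) u i.+1) = u 0 (+) u n.
Proof.
elim: n => [|n IH]; first by rewrite big_nil addbb.
by rewrite big_nat_recr //= IH addbA addbK.
Qed.

(** Apply [grid_sum] to [e s - f t]. Two sides of the square give the parities of [e] at the ends of
    [f]; the other two give those of [f] at the ends of [e], up to corrections at the corners. *)
Lemma near_ray_parity e f : continuous e -> continuous f ->
  (forall s t : R, 0 <= s <= 1 -> 0 <= t <= 1 -> e s <> f t) ->
  \forall N \near \oo,
    (ray_parity e (f 0) N (+) ray_parity e (f 1) N) (+)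
      (ray_parity f (e 0) N (+) ray_parity f (e 1) N) =
    (upper (f 0 - e 0) (+) upper (f 1 - e 0)) (+)
      (upper (f 0 - e 1) (+) upper (f 1 - e 1)).
Proof.
move=> ce cf ef; have := near_grid_cell ce cf ef; apply: filterS => N cell.
pose x i : R := i%:R / N.+1%:R.
have x0 : x 0 = 0 by rewrite /x mul0r.
have x1 : x N.+1 = 1 by rewrite /x divff.
have x01 i : (i <= N.+1)%N -> 0 <= x i <= 1.
  by move=> iN; rewrite /x divr_ge0 //= ler_pdivrMr // mul1r ler_nat.
pose h i j := ray_step (e (x i) - f (x j)) (e (x i.+1) - f (x j)).
pose v i j := ray_step (e (x i) - f (x j)) (e (x i) - f (x j.+1)).
have gridE i j i' j' : (i <= i' <= i.+1)%N -> (j <= j' <= j.+1)%N ->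
    grid_cell e f N i j (e (x i') - f (x j')).
  by move=> ? ?; exists i', j'.
(* With [e] fixed the difference is the negative of [f - e (x i)]; [ray_stepN] turns it around, and
   its corrections telescope. *)
have vE i : (i <= N)%N || (i == N.+1) ->
    \big[addb/false]_(0 <= j < N.+1) v i j =
    ray_parity f (e (x i)) N (+) (upper (f 0 - e (x i)) (+) upper (f 1 - e (x i))).
  move=> iN.
  have iN1 : (i <= N.+1)%N by case/orP: iN => [/leqW|/eqP->].
  rewrite -x0 -x1 -(telescope_addb N.+1 (fun j => upper (f (x j) - e (x i)))).
  rewrite /ray_parity -big_split /= !big_nat; apply: eq_bigr => j /= jN.
  (* The last grid line [i = N.+1] is the far side of cell [N]. *)
  have [k kN ki] : exists2 k, (k <= N)%N & (k <= i <= k.+1)%N.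
    case/orP: iN => [iN|/eqP->]; first by exists i; rewrite ?leqnn ?leqnSn.
    by exists N; rewrite ?leqnn ?leqnSn.
  have f0 t : (t <= N.+1)%N -> e (x i) - f (x t) != 0.
    by move=> tN; rewrite subr_eq0; apply/eqP/ef; exact: x01.
  rewrite /v [ray_step (_ (x i) - _) _](ray_stepN (cell k j kN jN)) ?opprB ?f0 // 1?ltnW //.
  - by apply: gridE; rewrite ?leqnn ?leqnSn.
  - by apply: gridE; rewrite ?leqnn ?leqnSn.
have hvE i j : (i < N.+1)%N -> (j < N.+1)%N ->
    h i j (+) v i.+1 j (+) (h i j.+1 (+) v i j) = false.
  by move=> iN jN; apply: (ray_step_cell (cell i j iN jN)); apply: gridE;
    rewrite ?leqnn ?leqnSn.
have hE j : \big[addb/false]_(0 <= i < N.+1) h i j = ray_parity e (f (x j)) N by [].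
have := grid_sum hvE; rewrite !vE ?eqxx ?orbT // !hE x0 x1.
case: (ray_parity e (f 0) N); case: (ray_parity e (f 1) N);
case: (ray_parity f (e 0) N); case: (ray_parity f (e 1) N);
case: (upper (f 0 - e 0)); case: (upper (f 1 - e 0));
by case: (upper (f 0 - e 1)); case: (upper (f 1 - e 1)).
Qed.

End RayCrossing.

(** * Independent edges of a drawing *)

Section Crossing.
Local Open Scope classical_set_scope.
Variable R : realType.

(** There are finitely many pairs, so one sampling [N] serves all disjoint ones; pairs that meet
    satisfy the implication trivially. *)
Lemma near_ray_parity_all (I : finType) (f : I -> R -> R * R) :
  (forall i, continuous (f i)) ->
  exists n : I -> R * R -> bool, forall i j,
    (forall s t : R, 0 <= s <= 1 -> 0 <= t <= 1 -> f i s <> f j t) ->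
    (n i (f j 0) (+) n i (f j 1)) (+) (n j (f i 0) (+) n j (f i 1)) =
    (upper (f j 0 - f i 0) (+) upper (f j 1 - f i 0)) (+)
      (upper (f j 0 - f i 1) (+) upper (f j 1 - f i 1)).
Proof.
move=> cf.
pose P i j := forall s t : R, 0 <= s <= 1 -> 0 <= t <= 1 -> f i s <> f j t.
have /filter_forall near_f (ij : I * I) : \forall N \near \oo, P ij.1 ij.2 ->
    (ray_parity (f ij.1) (f ij.2 0) N (+) ray_parity (f ij.1) (f ij.2 1) N) (+)
      (ray_parity (f ij.2) (f ij.1 0) N (+) ray_parity (f ij.2) (f ij.1 1) N) =
    (upper (f ij.2 0 - f ij.1 0) (+) upper (f ij.2 1 - f ij.1 0)) (+)
      (upper (f ij.2 0 - f ij.1 1) (+) upper (f ij.2 1 - f ij.1 1)).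
  case: ij => i j /=; have [dij|ndij] := pselect (P i j).
    by have := near_ray_parity (cf i) (cf j) dij; apply: filterS.
  by apply: nearW => N.
have [N nP] := filter_ex near_f.
by exists (fun i v => ray_parity (f i) v N) => i j; apply: (nP (i, j)).
Qed.

Lemma upperB (p q : R * R) : p <> q -> upper (q - p) = ~~ upper (p - q).
Proof. by move=> pq; rewrite -opprB upperN // subr_eq0; apply/eqP. Qed.

Lemma K33_curves (f : 'I_3 -> 'I_3 -> R -> R * R) (a b : 'I_3 -> R * R) :
  (forall i j, continuous (f i j)) ->
  (forall i j, f i j 0 = a i) -> (forall i j, f i j 1 = b j) ->
  exists i j k l s t, [/\ i != k, j != l, 0 <= s <= 1, 0 <= t <= 1
    & f i j s = f k l t].
Proof.
move=> cf f0 f1; apply: contrapT => disj.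
have {}disj i j k l : i != k -> j != l ->
    forall s t : R, 0 <= s <= 1 -> 0 <= t <= 1 -> f i j s <> f k l t.
  by move=> ik jl s t s01 t01 st; apply: disj; exists i, j, k, l, s, t.
have [n nP] := near_ray_parity_all (fun ij : 'I_3 * 'I_3 => cf ij.1 ij.2).
have in0 : 0 <= (0 : R) <= 1 by rewrite lexx ler01.
have in1 : 0 <= (1 : R) <= 1 by rewrite lexx ler01.
(* The points [a] and [b] are not assumed distinct; this follows from the disjointness of paths that
   end in them. *)
have other (i : 'I_3) : exists j, i != j.
  by exists (inord (i == 0)); case: i => -[|[|[]]] // ?; rewrite -val_eqE /= inordK.
have aD i k : i != k -> a i <> a k.
  move=> ik; have [l jl] := other ord0.
  by have := disj i ord0 k l ik jl 0 0 in0 in0; rewrite !f0.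
have bD j l : j != l -> b j <> b l.
  move=> jl; have [k ik] := other ord0.
  by have := disj ord0 j k l ik jl 1 1 in1 in1; rewrite !f1.
have abD i l : a i <> b l.
  have [k ik] := other i; have [j] := other l; rewrite eq_sym => jl.
  by have := disj i j k l ik jl 0 1 in0 in1; rewrite f0 f1.
apply: (@K33_parity (fun i j k => n (i, j) (a k)) (fun i j l => n (i, j) (b l))
  (fun k i => upper (a k - a i)) (fun l j => upper (b l - b j))
  (fun k j => upper (a k - b j))) => [i k /aD/upperB//|j l /bD/upperB//|i j k l ik jl].
have := nP (i, j) (k, l) (disj _ _ _ _ ik jl); rewrite /= !f0 !f1 => ->.
by rewrite (upperB (abD i l)).
Qed.

Lemma K5_curves (f : 'I_5 -> 'I_5 -> R -> R * R) (a : 'I_5 -> R * R) :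
  injective a -> (forall i j, continuous (f i j)) ->
  (forall i j : 'I_5, (i < j)%N -> f i j 0 = a i /\ f i j 1 = a j) ->
  exists (i j k l : 'I_5) (s t : R), [/\ uniq [:: i; j; k; l], (i < j)%N, (k < l)%N,
    0 <= s <= 1 /\ 0 <= t <= 1 & f i j s = f k l t].
Proof.
move=> inj_a cf fE; apply: contrapT => disj.
have {}disj (i j k l : 'I_5) : uniq [:: i; j; k; l] -> (i < j)%N -> (k < l)%N ->
    forall s t : R, 0 <= s <= 1 -> 0 <= t <= 1 -> f i j s <> f k l t.
  by move=> u ij kl s t s01 t01 st; apply: disj; exists i, j, k, l, s, t.
have [n nP] := near_ray_parity_all (fun ij : 'I_5 * 'I_5 => cf ij.1 ij.2).
apply: (@K5_parity (fun i j k => n (i, j) (a k)) (fun k i => upper (a k - a i))).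
  by move=> i k ik; apply: upperB => /inj_a ki; rewrite ki eqxx in ik.
move=> i j k l u ij kl; have := nP (i, j) (k, l) (disj _ _ _ _ u ij kl) => /=.
by case: (fE i j ij) => -> ->; case: (fE k l kl) => -> ->.
Qed.

(** Extends a path by constants beyond its ends, since the parity lemmas work with functions
    continuous on the whole line. *)
Lemma continuous_clamp (T : topologicalType) (f : R -> T) :
  {within `[0, 1], continuous f} ->
  continuous (fun t : R => f (Num.max 0 (Num.min 1 t))).
Proof.
move=> /subspace_continuousP cf t.
have in01 u : `[0, 1]%classic (Num.max 0 (Num.min 1 u) : R).
  by rewrite /= in_itv /= le_max lexx ge_max ler01 ge_min lexx.
have cclamp : continuous (fun u : R => Num.max 0 (Num.min 1 u)).
  move=> u.
  have ccst (c : R) : {for u, continuous (cst c : R -> R^o)} by exact: cvg_cst.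
  have cid : {for u, continuous (id : R -> R^o)} by exact: cvg_id.
  exact: (continuous_max (ccst 0) (continuous_min (ccst 1) cid)).
apply: (@cvg_comp _ _ _ (fun u : R => Num.max 0 (Num.min 1 u)) f _ _ _ _ (cf _ (in01 t))).
move=> A wA; have : \forall u \near t, `[0, 1]%classic (Num.max 0 (Num.min 1 u) : R) ->
    A (Num.max 0 (Num.min 1 u) : R) := cclamp t _ wA.
by apply: filterS => u /(_ (in01 u)).
Qed.

Lemma drawing_path (G : sgraph) (D : drawing R G) (u v : G) : adj u v ->
  exists f : R -> R * R, [/\ continuous f, f 0 = pos D u, f 1 = pos D v
    & forall t, 0 <= t <= 1 -> curve D [set u; v]%SET (f t)].
Proof.
move=> /(curve_simple D)[f [cf _ f0 f1 ->]].
exists (fun t => f (Num.max 0 (Num.min 1 t))); split; first exact: continuous_clamp.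
- by rewrite min_r ?ler01 // max_l.
- by rewrite min_l // max_r.
- by move=> t /andP[t0 t1]; rewrite min_r // max_r //; exists t => //=; rewrite in_itv /= t0.
Qed.

Lemma drawing_K33 (G : sgraph) (D : drawing R G) (a b : 'I_3 -> G) :
  (forall i j, adj (a i) (b j)) ->
  exists i j k l x, [/\ i != k, j != l,
    curve D [set a i; b j]%SET x & curve D [set a k; b l]%SET x].
Proof.
move=> ab.
have /choice[f fP] (ij : 'I_3 * 'I_3) := drawing_path D (ab ij.1 ij.2).
have [||| i [j [k [l [s [t [ik jl s01 t01 st]]]]]]] :=
  @K33_curves (fun i j => f (i, j)) (pos D \o a) (pos D \o b).
- by move=> i j; case: (fP (i, j)).
- by move=> i j; case: (fP (i, j)).
- by move=> i j; case: (fP (i, j)).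
exists i, j, k, l, (f (i, j) s); split=> //.
  by case: (fP (i, j)) => _ _ _; apply.
by rewrite st; case: (fP (k, l)) => _ _ _; apply.
Qed.

Lemma drawing_K5 (G : sgraph) (D : drawing R G) (a : 'I_5 -> G) :
  (forall i j, i != j -> adj (a i) (a j)) ->
  exists (i j k l : 'I_5) x, [/\ uniq [:: i; j; k; l],
    curve D [set a i; a j]%SET x & curve D [set a k; a l]%SET x].
Proof.
move=> aa.
have /choice[f fP] (ij : 'I_5 * 'I_5) : exists f : R -> R * R, continuous f /\
    ((ij.1 < ij.2)%N -> [/\ f 0 = pos D (a ij.1), f 1 = pos D (a ij.2)
      & forall t, 0 <= t <= 1 -> curve D [set a ij.1; a ij.2]%SET (f t)]).
  (* Only pairs [i < j] carry an edge; a constant path fills the other entries of the continuous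
     family. *)
  case: ltnP => [ij12|_]; last by exists (cst 0); split=> // x; exact: cvg_cst.
  have [|f [cf f0 f1 fc]] := @drawing_path _ D (a ij.1) (a ij.2).
    by apply: aa; rewrite neq_ltn ij12.
  by exists f.
have inj_a : injective (pos D \o a).
  move=> i j /(@pos_inj _ _ D) aij; apply/eqP/contraT => /aa.
  by rewrite aij adj_irrefl.
have [|| i [j [k [l [s [t [u ij kl [s01 t01] st]]]]]]] :=
  @K5_curves (fun i j => f (i, j)) (pos D \o a) inj_a.
- by move=> i j; case: (fP (i, j)).
- by move=> i j ij; case: (fP (i, j)) => _ /(_ ij)[].
exists i, j, k, l, (f (i, j) s); split=> //.
  by case: (fP (i, j)) => _ /(_ ij)[_ _]; apply.
by rewrite st; case: (fP (k, l)) => _ /(_ kl)[_ _]; apply.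
Qed.
End Crossing.

(** * Counting crossings *)

Definition disjoint_edges (G : sgraph) (e1 e2 : {set G}) :=
  forall v, v \in e1 -> v \notin e2.

Section Count.
Local Open Scope classical_set_scope.
Variable R : realType.

Lemma mem_edges (G : sgraph) (u v : G) : adj u v -> [set u; v]%SET \in edges G.
Proof. by move=> uv; apply/imsetP; exists (u, v); rewrite ?inE. Qed.

Lemma edges_neq (G : sgraph) (e1 e2 : {set G}) :
  e1 \in edges G -> disjoint_edges e1 e2 -> e1 != e2.
Proof.
case/imsetP => -[u v] _ -> /(_ u); rewrite !inE eqxx /= => /(_ isT).
by apply: contraNneq => <-; rewrite !inE eqxx.
Qed.

(** A third edge through [x] would force a common vertex of [e1] and [e2]. So the crossing point
    determines the pair of edges, up to order. *)
Lemma crossing_edges_union (G : sgraph) (D : drawing R G) (e1 e2 e1' e2' : {set G}) x :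
  e1 \in edges G -> e2 \in edges G -> disjoint_edges e1 e2 ->
  e1' \in edges G -> e2' \in edges G -> disjoint_edges e1' e2' ->
  curve D e1 x -> curve D e2 x -> curve D e1' x -> curve D e2' x ->
  (e1 :|: e2 = e1' :|: e2')%SET.
Proof.
move=> E1 E2 d E1' E2' d' c1 c2 c1' c2'.
have third e : e \in edges G -> curve D e x -> e = e1 \/ e = e2.
  move=> E c; have [->|ee1] := eqVneq e e1; first by left.
  have [->|ee2] := eqVneq e e2; first by right.
  rewrite eq_sym in ee1; rewrite eq_sym in ee2.
  have [v [v1 v2 _ _]] := curve_triple E1 E2 E (edges_neq E1 d) ee1 ee2 c1 c2 c.
  by move: (d v v1); rewrite v2.
have := edges_neq E1' d'.
by case: (third _ E1' c1') => ->; case: (third _ E2' c2') => ->;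
  rewrite ?eqxx // finset.setUC.
Qed.

(** Each index forces a crossing of disjoint edges whose vertices satisfy [Q i]. The point
    determines these vertices and hence [i], so the indices inject into the crossings. *)
Lemma le_crossing_number (G : sgraph) (I : finType) (Q : I -> {set G} -> Prop) :
  (forall i j S, Q i S -> Q j S -> i = j) ->
  (forall (D : drawing R G) i, exists e1 e2 x,
    [/\ e1 \in edges G, e2 \in edges G, disjoint_edges e1 e2 & Q i (e1 :|: e2)%SET] /\
    (curve D e1 x /\ curve D e2 x)) ->
  (#|I|%:R%:E <= crossing_number R G)%E.
Proof.
move=> Q_inj cross; apply: le_ereal_inf_tmp => _ [k [D Dk] <-].
rewrite lee_fin ler_nat.
have [->//|/card_gt0P[i0 _]] := posnP #|I|.
rewrite -card_le_II -(card_le_eqr Dk).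
have /choice[e1 /choice[e2 /choice[x xP]]] := cross D.
have inj_x : injective x.
  move=> i j xij; have [[E1 E2 d Qi] [c1 c2]] := xP i.
  have [[E1' E2' d' Qj] [c1' c2']] := xP j.
  rewrite -xij in c1' c2'; apply: Q_inj Qi _.
  by rewrite (crossing_edges_union E1 E2 d E1' E2' d' c1 c2 c1' c2').
pose y k := x (nth i0 (enum I) k).
have inj_y : {in `I_#|I| &, injective y}.
  move=> a b; rewrite !inE /= !cardE => aI bI /inj_x/eqP.
  by rewrite nth_uniq ?enum_uniq // => /eqP.
rewrite -(card_le_eql (inj_card_eq inj_y)); apply: subset_card_le => _ [a _ <-].
rewrite /y; move: (nth _ _ _) => i.
have [[E1 E2 d _] [c1 c2]] := xP i.
exists (e1 i), (e2 i); split; first by split=> //; exact: (edges_neq E1 d).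
by split=> // -[v [v1 v2 _]]; move: (d v v1); rewrite v2.
Qed.

Lemma join_crossings (b : bool) (p m N q k : nat) : (3 * q <= p)%N -> (3 * k <= m)%N ->
  ((N * (q * (k * k)))%:R%:E <= crossing_number R (join_graph b p m N))%E.
Proof.
move=> qp km.
have lta (r : 'I_q) (i : 'I_3) : (3 * r + i < p)%N by case: r i => r rq [i i3] /=; lia.
pose I : finType := ('I_N * ('I_q * ('I_k * 'I_k)))%type.
(* The third coordinate is a Latin square: any two of the three determine the pair, as [coE] shows
   below. *)
pose co (x : I) (j : 'I_3) : nat := 
  nth 0%N [:: val x.2.2.1; val x.2.2.2; (x.2.2.1 + x.2.2.2) %% k]%N j.
have cok (x : I) (j : 'I_3) : (co x j < k)%N.
  case: x j => c [r [[s sk] [t tk]]] [[|[|[|j]]] //= j3]; rewrite /co //=.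
  by rewrite ltn_mod (leq_trans _ sk).
have ltb (x : I) (j : 'I_3) : (k * j + co x j < m)%N.
  by have := cok x j; case: j => -[|[|[|]]] //= ?; lia.
pose va (x : I) (i : 'I_3) : join_graph b p m N := (x.1, inl (Ordinal (lta x.2.1 i))).
pose vb (x : I) (j : 'I_3) : join_graph b p m N := (x.1, inr (Ordinal (ltb x j))).
have va_inj x y i j : va x i = va y j -> [/\ x.1 = y.1, x.2.1 = y.2.1 & i = j].
  case=> c /eqP; move: x.2.1 y.2.1 c => r r' -> /eqP eq_rr.
  split=> //; apply: val_inj => /=.
    by case: r r' i j eq_rr => r ? [r' ?] [i ?] [j ?] /=; lia.
  by case: r r' i j eq_rr => r ? [r' ?] [i ?] [j ?] /=; lia.
have vb_inj x y i j : vb x i = vb y j -> i = j /\ co x i = co y j.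
  case=> _ eq_co; have := cok x i; have := cok y j.
  have ij : i = j :> nat.
    by move: eq_co; have := cok x i; have := cok y j;
      move: (co x i) (co y j) => u v; case: i j => -[|[|[|]]] //= ? [[|[|[|]]] //= ?]; nia.
  by split; [exact: val_inj|move: eq_co; rewrite ij; lia].
have vab x y i j : (va x i == vb y j) = false by apply/eqP => -[].
have vba x y i j : (vb x i == va y j) = false by apply/eqP => -[].
have ab x i j : adj (va x i) (vb x j) by rewrite /= /join_adj /= eqxx.
have coE x y i j : i != j -> co x i = co y i -> co x j = co y j -> x.2.2 = y.2.2.
  case: x y => c [r [[s sk] [t tk]]] [c' [r' [[s' sk'] [t' tk']]]] ij eqi eqj.
  suff [ss tt] : s = s' /\ t = t' by congr pair; exact: val_inj.
  move: ij eqi eqj; rewrite /co.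
  have modD u v w : (v < k)%N -> (w < k)%N -> ((u + v) %% k = (u + w) %% k)%N -> v = w.
    by move=> vk wk /eqP; rewrite eqn_modDl !modn_small // => /eqP.
  case: i j => -[|[|[|]]] //= ? [[|[|[|]]] //= ?] _ ei ej; split=> //; subst.
  - exact: modD ej.
  - by apply: (@modD t'); rewrite // ![(t' + _)%N]addnC.
  - exact: modD ei.
  - by apply: (@modD t'); rewrite // ![(t' + _)%N]addnC.
move: va vb va_inj vb_inj vab vba ab => va vb va_inj vb_inj vab vba ab.
move: co coE {cok ltb} vb_inj => co coE vb_inj.
(* Two independent edges span two [inl] and two [inr] vertices. The former reveal the copy and the
   triple, the latter two coordinates, which together is all of [x]. *)
pose Q (x : I) (S : {set join_graph b p m N}) := exists i k j l,
  i != k /\ j != l /\ S = [set va x i; vb x j; va x k; vb x l]%SET.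
have -> : (N * (q * (k * k)))%N = #|I| by rewrite !card_prod !card_ord.
apply: (@le_crossing_number _ I Q) => [x y S|D x]; last first.
  have [i [j [i' [j' [z [ii' jj' c1 c2]]]]]] := drawing_K33 D (ab x).
  exists [set va x i; vb x j]%SET, [set va x i'; vb x j']%SET, z.
  split=> //; split; try exact: mem_edges.
    move=> v; rewrite !inE => /orP[] /eqP->; rewrite negb_or ?vab ?vba ?andbT /=.
      by apply: contra_neqN ii' => /eqP/va_inj[].
    by apply: contra_neqN jj' => /eqP/vb_inj[].
  exists i, i', j, j'; split; [exact: ii'|split; [exact: jj'|]].
  apply/setP => v; rewrite !inE.
  by case: (v == va x i) (v == vb x j) (v == va x i') (v == vb x j') => [] [] [] [].
move=> [i [i' [j [j' [ii' [jj' ->]]]]]] [h [h' [l [l' [hh' [ll' /setP eqS]]]]]].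
have sub v : v \in [:: va x i; vb x j; va x i'; vb x j'] ->
    v \in [:: va y h; vb y l; va y h'; vb y l'].
  by have := eqS v; rewrite !inE -!orbA => ->.
have [c r] : x.1 = y.1 /\ x.2.1 = y.2.1.
  have := sub (va x i); rewrite !inE eqxx => /(_ isT).
  by rewrite !vab /= !orbF => /orP[] /eqP /va_inj[].
have vbS t : t \in [:: j; j'] -> co x t = co y t.
  rewrite !inE => tj; have := sub (vb x t).
  rewrite !inE !vba /=.
  have -> : (vb x t == vb x j) || (vb x t == vb x j').
    by case/orP: tj => /eqP->; rewrite eqxx ?orbT.
  by move=> /(_ isT)/orP[] /eqP/vb_inj[<-].
have [cj cj'] := (vbS j (mem_head _ _), vbS j' (mem_last j [:: j'])).
by have := coE x y j j' jj' cj cj';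
  case: x y c r {sub vbS cj cj' eqS} => [? [? ?]] [? [? ?]] /= -> -> ->.
Qed.

(** Each copy of the join of a 4-clique with one vertex is a $K_5$, and crossings in different
    copies have different vertices. *)
Lemma K5_crossings (N : nat) : (N%:R%:E <= crossing_number R (join_graph true 4 1 N))%E.
Proof.
pose G := join_graph true 4 1 N.
pose a (c : 'I_N) (i : 'I_5) : G := (c, fintype.split (i : 'I_(4 + 1))).
have aa c i j : i != j -> adj (a c i) (a c j).
  move=> ij; rewrite /= /join_adj eqxx /=.
  have : fintype.split (i : 'I_(4 + 1)) != fintype.split (j : 'I_(4 + 1)).
    by apply: contra_neq ij; exact: (can_inj (@fintype.splitK 4 1)).
  by case: fintype.split => i'; case: fintype.split => j' //; rewrite !ord1 eqxx.
rewrite -[X in X%:R](card_ord N).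
pose Q (c : 'I_N) (S : {set G}) := S != finset.set0 /\ forall v, v \in S -> v.1 = c.
apply: (@le_crossing_number _ _ Q) => [c c' S [/finset.set0Pn[v Sv] Sc] [_ Sc']|D c].
  by rewrite -(Sc v Sv) (Sc' v Sv).
have [i [j [k [l [x [u c1 c2]]]]]] := drawing_K5 D (aa c).
have inj_a : injective (a c) by move=> ? ? [/(can_inj (@fintype.splitK 4 1))].
move: u; rewrite /= !inE !negb_or andbT => /and3P[/and3P[ij ik il] /andP[jk jl] kl].
exists [set a c i; a c j]%SET, [set a c k; a c l]%SET, x.
split=> //; split.
- exact: (mem_edges (aa c i j ij)).
- exact: (mem_edges (aa c k l kl)).
- by move=> v; rewrite !inE !negb_or => /orP[] /eqP->; rewrite !(inj_eq inj_a) ?ik ?il ?jk ?jl.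
split; first by apply/finset.set0Pn; exists (a c i); rewrite !inE eqxx.
by move=> v; rewrite !inE -!orbA => /or4P[] /eqP->.
Qed.

(** * Infinite families and choice of parameters *)

Lemma giso_card (G H : sgraph) : giso G H -> #|G| = #|H|.
Proof. by case=> f /bij_eq_card. Qed.

(** Different numbers of copies give different orders, hence non-isomorphic graphs; taking [i.+1]
    copies avoids the empty graph. *)
Lemma join_family (h Delta : nat) (b : bool) (p m : nat) (c : R) :
  (p + 2 <= h)%N -> (0 < p <= b * p.-1 + m)%N -> (b * p.-1 + m = Delta)%N ->
  ((6 <= h)%N -> b) ->
  (forall N, ((c * h%:R * Delta%:R * (N * (p + m))%:R)%:E <=
    crossing_number R (join_graph b p m N))%E) ->
  exists G : nat -> sgraph,
    (forall i j : nat, i <> j -> ~ giso (G i) (G j)) /\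
    (forall i : nat,
      [/\ ~ is_minor (complete_graph h) (G i),
          max_degree (G i) = Delta,
          ((c * h%:R * Delta%:R * #|G i|%:R)%:E <= crossing_number R (G i))%E
        & (6 <= h)%N -> chordal (G i)]).
Proof.
move=> ph /andP[p0 pm] <- hb cr; exists (fun i => join_graph b p m i.+1); split.
  move=> i j ij /giso_card; rewrite !card_join_graph => /eqP.
  by rewrite eqn_mul2r addn_eq0 eqn0Ngt p0 /= => /eqP[].
move=> i; split.
- exact: join_graph_minor.
- exact: max_degree_join.
- by rewrite card_join_graph.
- by move=> /hb bT; exact: join_graph_chordal.
Qed.

Lemma bound_from_nat (h Delta n k : nat) (x : \bar R) : (h * Delta * n <= 2400 * k)%N ->
  (k%:R%:E <= x)%E -> ((2400%:R^-1 * h%:R * Delta%:R * n%:R)%:E <= x)%E.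
Proof.
move=> le; apply: le_trans; rewrite lee_fin -!mulrA ler_pdivrMl ?ltr0n //.
by rewrite -!natrM ler_nat mulnA.
Qed.
End Count.

Theorem lemma6 (R : realType) :
  exists2 c : R, 0 < c &
    forall h Delta : nat, (5 <= h)%N -> (0 < Delta)%N ->
      ((6 <= h)%N -> (h - 2 %| Delta)%N) ->
      (h = 5%N -> (3 %| Delta)%N) ->
      exists G : nat -> sgraph,
        (forall i j : nat, i <> j -> ~ giso (G i) (G j)) /\
        (forall i : nat,
          [/\ ~ is_minor (complete_graph h) (G i),
              max_degree (G i) = Delta,
              ((c * h%:R * Delta%:R * #|G i|%:R)%:E <= crossing_number R (G i))%E
            & (6 <= h)%N -> chordal (G i)]).
Proof.
(* 2400 = 10 * 15 * 16 is the product of the constants in [hq], [Dk] and [nk] below. *)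
exists (2400%:R^-1) => [|h Delta h5 D0 hD h3]; first by rewrite invr_gt0 ltr0n.
move: h5; rewrite leq_eqVlt => /orP[/eqP h5|h6].
  (* For [h = 5] the graphs are copies of $K_{3,\Delta}$, with one triple and blocks of size
     $\Delta/3$. *)
  have /dvdnP[k Dk] := h3 (esym h5).
  apply: (@join_family R h Delta false 3 Delta) => [|||h6|N]; [lia|lia|lia|lia|].
  apply: bound_from_nat (@join_crossings R false 3 Delta N 1 k _ _); [|lia|lia].
  have k1 : (0 < k)%N by lia.
  subst; nia.
have hDelta : (h - 2 <= Delta)%N by apply: dvdn_leq D0 (hD h6).
have [D5|D4] := leqP 5 Delta.
  (* Here [3 * q <= h - 2], and [m] makes the clique vertices have degree [Delta]. Since
     [5 * q <= Delta + 1], at least two fifths of the [Delta + 1] vertices of a copy are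
     independent; with [5 <= Delta] this gives [m >= 3], so [k] is positive. *)
  pose q := ((h - 1) %/ 5)%N; pose m := (Delta + 1 - 3 * q)%N; pose k := (m %/ 3)%N.
  apply: (@join_family R h Delta true (3 * q) m) => // [|||N].
  - lia.
  - lia.
  - lia.
  apply: bound_from_nat (@join_crossings R true (3 * q) m N q k _ _); [|lia|lia].
  have hq : (h <= 10 * q)%N by lia.
  have Dk : (Delta <= 15 * k)%N by lia.
  have nk : (3 * q + m <= 16 * k)%N by lia.
  have := leq_mul (leq_mul hq Dk) nk.
  nia.
(* In this case [m] would be 2, too small for a $K_{3,3}$ as above, so copies of $K_5$ take over. *)
have [-> ->] : h = 6 /\ Delta = 4 by lia.
apply: (@join_family R 6 4 true 4 1) => // N.
by apply: bound_from_nat (@K5_crossings R N); lia.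
Qed.
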